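(* Let $S$ be a monoid and let $\cdot\colon A\times S\to A$ be a strong partial action of $S$ on a set $A$ in the monoid sense, i.e. a partial map satisfying: (PA) if $a\cdot s$ and $(a\cdot s)\cdot t$ are defined then $a\cdot st$ is defined and $(a\cdot s)\cdot t=a\cdot st$; (Um) for all $a\in A$, $a\cdot 1$ is defined and $a\cdot 1=a$; (S) if $a\cdot s$ and $a\cdot st$ are defined then $(a\cdot s)\cdot t$ is defined and $(a\cdot s)\cdot t=a\cdot st$. Then $A\otimes S$ (i.e. the triple $(A\otimes S,\delta,* )$) is an initial object and $A^S$ (i.e. the triple $(A^S,\lambda,* )$) is a terminal object in the category $\mathcal{G}_A(A,S,\cdot)$ of $A$-generated globalizations of $(A,\cdot)$. In particular, if $*$ is a global action of $S$ on a set $B$ which is an $A$-generated globalization of $\cdot$ via a map $\iota\colon A\to B$, then there are unique morphisms of global $S$-acts $\varphi\colon A\otimes S\to B$ and $\psi\colon B\to A^S$ such that $\varphi\delta=\iota$ and $\psi\iota=\lambda$; they are given by $\varphi(a\otimes s)=\iota(a)*s$ and $\psi(\iota(a)*s)=f_{a,s}$ for all $a\in A$, $s\in S$.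
   Context: A partial map $f\colon X\to Y$ is a map $Z\to Y$ with $Z\subseteq X$, $Z=\mathrm{dom}(f)$; $f(x)$ is defined iff $x\in Z$; two partial maps are equal iff they have the same domain and the same values. All actions are right actions. A global action of $S$ on a set $B$ is a map $*\colon B\times S\to B$ with $(b*s)*t=b*(st)$; then $(B,* )$ is a global $S$-act. A morphism of global $S$-acts $(B,* )\to(C,\circ)$ is a map $\varphi$ with $\varphi(b*s)=\varphi(b)\circ s$. A globalization of $(A,\cdot)$ is a global $S$-act $(B,* )$ together with an injective map $\iota\colon A\to B$ such that for all $a\in A,s\in S$: (G1) $a\cdot s$ is defined iff $\iota(a)*s\in\iota(A)$; (G2) if $a\cdot s$ is defined then $\iota(a\cdot s)=\iota(a)*s$. It is $A$-generated if every $b\in B$ equals $\iota(a)*s$ for some $a\in A$, $s\in S$. The category $\mathcal{G}_A(A,S,\cdot)$ has as objects the triples $(B,\iota,* )$ where $(B,* )$ is an $A$-generated globalization of $(A,\cdot)$ via $\iota$; a morphism $(B,\iota,* )\to(C,i,\circ)$ is a morphism of global $S$-acts $\varphi\colon B\to C$ with $\varphi\iota=i$. Tensor product: for $(a,s),(b,t)\in A\times S$ write $(a,s)\to(b,t)$ if there is $u\in S$ such that $s=ut$ and $a\cdot u$ is defined and equals $b$. Let $\rho$ be the smallest equivalence relation on $A\times S$ containing $\to$; $A\otimes S=(A\times S)/\rho$, and $a\otimes s$ is the $\rho$-class of $(a,s)$. $S$ acts globally on $A\otimes S$ by $(a\otimes s)*t=a\otimes st$. The (well-defined) map $\delta\colon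 A\to A\otimes S$ is $\delta(a)=b\otimes t$ whenever $a=b\cdot t$. For $a\in A$, $s\in S$ let $f_{a,s}\colon S\to A$ be the partial map with $\mathrm{dom}(f_{a,s})=\{t\in S: a\cdot st\text{ is defined}\}$ and $f_{a,s}(t)=a\cdot st$. Put $A^S=\{f_{a,s}: a\in A,s\in S\}$, with the (well-defined) global action $f_{a,s}*t=f_{a,st}$. The (well-defined) map $\lambda\colon A\to A^S$ is $\lambda(a)=f_{b,s}$ whenever $a=b\cdot s$. *)

(* Defs.v *)
From Stdlib Require Export Relation_Operators.
From mathcomp Require Export all_boot.
From mathcomp Require Export boolp classical_sets.

Set Implicit Arguments.
Unset Strict Implicit.
Unset Printing Implicit Defensive.

Local Open Scope classical_set_scope.
Local Open Scope group_scope.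

(* A partial map X -> Y is a map X -> option Y with domain
   [set x | isSome (f x)]; equality of such maps is equality of the domains
   and of the values. *)

Record strong_paction (S : monoidType) (A : Type) := StrongPAction {
  pact :> A -> S -> option A;
  pact_PA : forall a s b t c,
    pact a s = Some b -> pact b t = Some c -> pact a (s * t) = Some c;
  pact_Um : forall a, pact a 1 = Some a;
  pact_S : forall a s b t c,
    pact a s = Some b -> pact a (s * t) = Some c -> pact b t = Some c }.

(* Unitality b * 1 = b is deliberately not required of a global action. *)
Record global_act (S : monoidType) := GlobalAct {
  gcarrier :> Type;
  gact : gcarrier -> S -> gcarrier;
  gactA : forall b s t, gact (gact b s) t = gact b (s * t) }.

Definition act_morphism (S : monoidType) (B C : global_act S) (phi : B -> C) :=
  forall b s, phi (gact b s) = gact (phi b) s.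

Record category := Category {
  ob : Type;
  hom : ob -> ob -> Type;
  idm : forall X, hom X X;
  compm : forall X Y Z, hom Y Z -> hom X Y -> hom X Z;
  compm1 : forall X Y (f : hom X Y), compm f (idm X) = f;
  comp1m : forall X Y (f : hom X Y), compm (idm Y) f = f;
  compmA : forall X Y Z W (h : hom Z W) (g : hom Y Z) (f : hom X Y),
    compm h (compm g f) = compm (compm h g) f }.

Definition initial (C : category) (X : ob C) :=
  forall Y : ob C, exists f : hom X Y, forall g : hom X Y, g = f.

Definition terminal (C : category) (X : ob C) :=
  forall Y : ob C, exists f : hom Y X, forall g : hom Y X, g = f.

Section Globalizations.
Context {S : monoidType} {A : Type}.
Variable act : strong_paction S A.

Record globalization (B : global_act S) (iota : A -> B) : Prop := {
  glob_inj : injective iota;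
  glob_G1 : forall a s, isSome (act a s) <-> range iota (gact (iota a) s);
  glob_G2 : forall a s b, act a s = Some b -> iota b = gact (iota a) s }.

Definition generated (B : global_act S) (iota : A -> B) :=
  forall b : B, exists a s, b = gact (iota a) s.

Record gen_glob := GenGlob {
  gg_act :> global_act S;
  gg_map : A -> gg_act;
  gg_glob : globalization gg_map;
  gg_gen : generated gg_map }.

Definition gg_hom (X Y : gen_glob) : Type :=
  {phi : X -> Y | act_morphism phi /\ phi \o @gg_map X = @gg_map Y}.

Lemma gg_hom_eq X Y (f g : gg_hom X Y) : sval f = sval g -> f = g.
Proof. by case: f g => f pf [g pg] /= e; case: g / e pg => pg; congr exist. Qed.

Definition gg_id X : gg_hom X X :=
  exist _ idfun (conj (fun _ _ => erefl) erefl).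

Lemma gg_comp_subproof X Y Z (g : gg_hom Y Z) (f : gg_hom X Y) :
  act_morphism (sval g \o sval f) /\
  (sval g \o sval f) \o @gg_map X = @gg_map Z.
Proof.
case: g f => g [gM gE] [f [fM fE]] /=; split; first by move=> b s /=; rewrite fM gM.
by rewrite -gE -fE.
Qed.

Definition gg_comp X Y Z (g : gg_hom Y Z) (f : gg_hom X Y) : gg_hom X Z :=
  exist _ (sval g \o sval f) (gg_comp_subproof g f).

Definition gen_glob_cat : category.
Proof.
by apply: (@Category gen_glob gg_hom gg_id gg_comp) => *; exact: gg_hom_eq.
Defined.

End Globalizations.

Section Tensor.
Context {S : monoidType} {A : Type}.
Variable act : strong_paction S A.

Definition tens_step (p q : A * S) :=
  exists2 u : S, p.2 = u * q.2 & act p.1 u = Some q.1.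

Definition tens_rho : A * S -> A * S -> Prop := clos_refl_sym_trans _ tens_step.

Definition tens_class (p : A * S) : set (A * S) := [set q | tens_rho p q].

(* The quotient is the set of rho-classes, viewed as a type. *)
Definition tensor : Type := set_type (range tens_class).

Definition tens (a : A) (s : S) : tensor :=
  exist _ (tens_class (a, s)) (mem_set (imageP tens_class I)).

Lemma tensP (x : tensor) : exists p, x = tens p.1 p.2.
Proof.
case: x => C CP; have [[a s] _ e] := set_mem CP.
by exists (a, s); apply: val_inj; rewrite /= e.
Qed.

Lemma tens_eq a s b t : tens_rho (a, s) (b, t) -> tens a s = tens b t.
Proof.
move=> r; apply: val_inj => /=; apply/seteqP; split => q /= h.
  by apply: rst_trans h; exact: rst_sym.
exact: rst_trans h.
Qed.

Lemma tens_rhoP a s b t : tens a s = tens b t -> tens_rho (a, s) (b, t).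
Proof.
move=> /(congr1 val) /= e; apply: rst_sym.
by change (tens_class (b, t) (a, s)); rewrite -e; exact: rst_refl.
Qed.

Lemma tens_rhoM t p q : tens_rho p q -> tens_rho (p.1, p.2 * t) (q.1, q.2 * t).
Proof.
elim=> [x y [u e h]|x|x y _ IH|x y z _ IH1 _ IH2].
- by apply: rst_step; exists u => //=; rewrite e mulgA.
- exact: rst_refl.
- exact: rst_sym.
- exact: rst_trans IH1 IH2.
Qed.

Lemma tens_op_ex :
  exists op : tensor -> S -> tensor, forall a s t, op (tens a s) t = tens a (s * t).
Proof.
pose r x := projT1 (cid (tensP x)); have rP x := projT2 (cid (tensP x)).
exists (fun x t => tens (r x).1 ((r x).2 * t)) => a s t.
exact: (tens_eq (tens_rhoM t (tens_rhoP (esym (rP (tens a s)))))).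
Qed.

(* The maps that are only determined through well-definedness (here and for
   delta, fas_op and lambda below) are chosen from the existence lemma.  They
   are unique, since tens and fas are onto and act a 1 = Some a. *)
Definition tens_op : tensor -> S -> tensor := projT1 (cid tens_op_ex).

Lemma tens_opE a s t : tens_op (tens a s) t = tens a (s * t).
Proof. exact: (projT2 (cid tens_op_ex)). Qed.

Lemma tens_opA x s t : tens_op (tens_op x s) t = tens_op x (s * t).
Proof. by have [[a u] ->] := tensP x; rewrite !tens_opE mulgA. Qed.

Definition tensor_act : global_act S := GlobalAct tens_opA.

Lemma delta_ex a :
  exists x : tensor_act, forall b t, act b t = Some a -> x = tens b t.
Proof.
exists (tens a 1) => b t h; apply/esym/tens_eq/rst_step.
by exists t; rewrite ?mulg1.
Qed.

Definition delta (a : A) : tensor_act := projT1 (cid (delta_ex a)).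

Lemma deltaE a b t : act b t = Some a -> delta a = tens b t.
Proof. exact: (projT2 (cid (delta_ex a))). Qed.

End Tensor.

Section Functions.
Context {S : monoidType} {A : Type}.
Variable act : strong_paction S A.

Definition fas_fun (p : A * S) : S -> option A := fun t => act p.1 (p.2 * t).

Definition fspace : Type := set_type (range fas_fun).

Definition fas (a : A) (s : S) : fspace :=
  exist _ (fas_fun (a, s)) (mem_set (imageP fas_fun I)).

Lemma fasP (x : fspace) : exists p, x = fas p.1 p.2.
Proof.
case: x => f fP; have [[a s] _ e] := set_mem fP.
by exists (a, s); apply: val_inj; rewrite /= e.
Qed.

Lemma fas_op_ex :
  exists op : fspace -> S -> fspace, forall a s t, op (fas a s) t = fas a (s * t).
Proof.
pose r x := projT1 (cid (fasP x)); have rP x := projT2 (cid (fasP x)).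
exists (fun x t => fas (r x).1 ((r x).2 * t)) => a s t.
apply: val_inj => /=; apply: funext => u; rewrite /fas_fun /= -!mulgA.
by have /(congr1 val)/(congr1 (fun f => f (t * u))) := rP (fas a s).
Qed.

Definition fas_op : fspace -> S -> fspace := projT1 (cid fas_op_ex).

Lemma fas_opE a s t : fas_op (fas a s) t = fas a (s * t).
Proof. exact: (projT2 (cid fas_op_ex)). Qed.

Lemma fas_opA x s t : fas_op (fas_op x s) t = fas_op x (s * t).
Proof. by have [[a u] ->] := fasP x; rewrite !fas_opE mulgA. Qed.

Definition fspace_act : global_act S := GlobalAct fas_opA.

Lemma lambda_ex a :
  exists x : fspace_act, forall b s, act b s = Some a -> x = fas b s.
Proof.
exists (fas a 1) => b s h; apply: val_inj => /=; apply: funext => t.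
rewrite /fas_fun /= mul1g; case e: (act a t) => [c|].
  by rewrite (pact_PA h e).
by case e': (act b (s * t)) => [c|] //; rewrite (pact_S h e') in e.
Qed.

Definition lambda (a : A) : fspace_act := projT1 (cid (lambda_ex a)).

Lemma lambdaE a b s : act b s = Some a -> lambda a = fas b s.
Proof. exact: (projT2 (cid (lambda_ex a))). Qed.

End Functions.

(* Main.v *)
(* A morphism out of an A-generated act is determined by its values
   iota(a) * s |-> j(a) * s, and exists exactly when this assignment is well
   defined.  The elementary steps generating rho are forced in every
   globalization by (G2), which gives the morphism out of A (x) S; and
   iota(a) * s determines the partial map f_{a,s}, because by (G1) and (G2) the
   value a . st is the preimage under iota of (iota(a) * s) * t.  Applying the
   former to lambda shows that a (x) s determines f_{a,s}, so delta inherits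
   injectivity and (G1) from lambda. *)

Require Import Defs.

Set Implicit Arguments.
Unset Strict Implicit.
Unset Printing Implicit Defensive.

Local Open Scope classical_set_scope.
Local Open Scope group_scope.

(** Global acts need not be unital, so unitality is asked on the images of [iota] and [j]: it
    identifies [iota a] with [gact (iota a) 1], where the value of [phi] is prescribed. *)
Lemma generated_factor (S : monoidType) (A : Type) (B C : global_act S)
    (iota : A -> B) (j : A -> C) :
  generated iota ->
  (forall a, gact (iota a) 1 = iota a) -> (forall a, gact (j a) 1 = j a) ->
  (forall a s b t, gact (iota a) s = gact (iota b) t ->
     gact (j a) s = gact (j b) t) ->
  exists2 phi : B -> C,
    unique (fun phi : B -> C => act_morphism phi /\ phi \o iota = j) phi
  & forall a s, phi (gact (iota a) s) = gact (j a) s.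
Proof.
move=> gen iota1 j1 jE.
(* The value at [b] is required to fit every representation of [b] at once, so the chosen function
   needs no further well-definedness argument. *)
have /choice [phi phiP] : forall b : B, exists c : C,
    forall a s, b = gact (iota a) s -> c = gact (j a) s.
  move=> b; have [a [s ->]] := gen b.
  by exists (gact (j a) s) => a' s'; exact: jE.
have phiE a s : phi (gact (iota a) s) = gact (j a) s by exact: phiP.
exists phi => //; split.
  split=> [b s|]; last by apply: funext => a /=; rewrite -iota1 phiE j1.
  by have [a [t ->]] := gen b; rewrite gactA !phiE gactA.
move=> psi [psiM psi_iota]; apply: funext => b.
by have [a [s ->]] := gen b; rewrite phiE psiM -psi_iota.
Qed.

Section Universality.
Context {S : monoidType} {A : Type}.
Variable act : strong_paction S A.

(** This is (G2) applied to [act a 1 = Some a]. *)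
Lemma glob_act1 (B : global_act S) (iota : A -> B) a :
  globalization act iota -> gact (iota a) 1 = iota a.
Proof. by move=> gl; rewrite -(glob_G2 gl (pact_Um act a)). Qed.

Lemma delta_gact a s : gact (delta act a) s = tens act a s.
Proof. by rewrite (deltaE (pact_Um act a)) /= tens_opE mul1g. Qed.

Lemma lambda_gact a s : gact (lambda act a) s = fas act a s.
Proof. by rewrite (lambdaE (pact_Um act a)) /= fas_opE mul1g. Qed.

Lemma generated_delta : generated (delta act).
Proof.
by move=> x; have [[a s] ->] := tensP x; exists a, s; rewrite delta_gact.
Qed.

Lemma generated_lambda : generated (lambda act).
Proof.
by move=> x; have [[a s] ->] := fasP x; exists a, s; rewrite lambda_gact.
Qed.

(** Evaluation at [1] recovers [act a s] from [fas a s]. Injectivity, (G1) and (G2) for [lambda] all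
    follow from this equivalence. *)
Lemma lambda_eq_fas b a s :
  lambda act b = fas act a s <-> act a s = Some b.
Proof.
split=> [|h]; last exact: lambdaE.
rewrite (lambdaE (pact_Um act b)).
by move=> /(congr1 (fun f => val f 1)); rewrite /= /fas_fun /= !mulg1 pact_Um.
Qed.

Lemma globalization_lambda : globalization act (lambda act).
Proof.
split=> [a b|a s|a s b h]; last by rewrite lambda_gact; exact/lambda_eq_fas.
(* Injectivity is the case [s = 1] of the equivalence. *)
- rewrite (lambdaE (pact_Um act b)) => /lambda_eq_fas.
  by rewrite pact_Um => -[].
- rewrite lambda_gact; split=> [|[b _ /lambda_eq_fas -> //]].
  by case e: (act a s) => [b|] // _; exists b => //; exact/lambda_eq_fas.
Qed.

Lemma tens_eq_gact (B : global_act S) (iota : A -> B) a s b t :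
  globalization act iota -> tens act a s = tens act b t ->
  gact (iota a) s = gact (iota b) t.
Proof.
move=> gl e; have := tens_rhoP e.
suff h p q : tens_rho act p q -> gact (iota p.1) p.2 = gact (iota q.1) q.2.
  exact: h.
(* For a generating step, [iota a * (u * t) = (iota a * u) * t = iota b * t] by (G2). *)
elim=> [x y [u -> h]|//|//|x y z _ -> _ -> //].
by rewrite -gactA -(glob_G2 gl h).
Qed.

Lemma delta_eq_tens b a s :
  delta act b = tens act a s <-> act a s = Some b.
Proof.
split=> [|h]; last exact: deltaE.
rewrite (deltaE (pact_Um act b)).
(* Mapping the equality into the function space avoids any analysis of chains of generating
   steps. *)
move=> /(tens_eq_gact globalization_lambda).
by rewrite (glob_act1 _ globalization_lambda) lambda_gact => /lambda_eq_fas.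
Qed.

Lemma globalization_delta : globalization act (delta act).
Proof.
split=> [a b|a s|a s b h]; last by rewrite delta_gact; exact/delta_eq_tens.
- rewrite (deltaE (pact_Um act b)) => /delta_eq_tens.
  by rewrite pact_Um => -[].
- rewrite delta_gact; split=> [|[b _ /delta_eq_tens -> //]].
  by case e: (act a s) => [b|] // _; exists b => //; exact/delta_eq_tens.
Qed.

Lemma gact_eq_fas (B : global_act S) (iota : A -> B) a s b t :
  globalization act iota -> gact (iota a) s = gact (iota b) t ->
  fas act a s = fas act b t.
Proof.
move=> gl e; apply: val_inj; apply: funext => r; rewrite /= /fas_fun /=.
(* (G1) supplies a value and (G2) with injectivity identifies it, so the graph of [act] is read off
   from [B]. *)
have actP x u c : act x u = Some c <-> iota c = gact (iota x) u.
  split=> [/(glob_G2 gl) //|h].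
  have : isSome (act x u) by apply/(glob_G1 gl); exists c.
  case eu: (act x u) => [d|] // _; congr Some; apply: (glob_inj gl).
  by rewrite h (glob_G2 gl eu).
have {}e : gact (iota a) (s * r) = gact (iota b) (t * r) by rewrite -!gactA e.
case ea: (act a (s * r)) => [c|].
  by apply/esym/actP; rewrite -e; exact/actP.
case eb: (act b (t * r)) => [c|] //.
(* Definedness on the right alone is impossible: [None] is turned back into [act a (s * r)], which
   [actP] shows to be [Some c]. *)
by rewrite -ea; apply/actP; rewrite e; exact/actP.
Qed.

Lemma tensor_universal (B : global_act S) (iota : A -> B) :
  globalization act iota ->
  exists2 phi : tensor_act act -> B,
    unique (fun phi : tensor_act act -> B =>
              act_morphism phi /\ phi \o delta act = iota) phi
  & forall a s, phi (tens act a s) = gact (iota a) s.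
Proof.
move=> gl.
have [||a s b t|phi phiU phiE] :=
  generated_factor (j := iota) generated_delta.
- by move=> a; rewrite (glob_act1 _ globalization_delta).
- by move=> a; rewrite (glob_act1 _ gl).
- by rewrite !delta_gact; exact: tens_eq_gact.
- by exists phi => // a s; rewrite -delta_gact phiE.
Qed.

Lemma fspace_universal (B : global_act S) (iota : A -> B) :
  globalization act iota -> generated iota ->
  exists2 psi : B -> fspace_act act,
    unique (fun psi : B -> fspace_act act =>
              act_morphism psi /\ psi \o iota = lambda act) psi
  & forall a s, psi (gact (iota a) s) = fas act a s.
Proof.
move=> gl gen.
have [||a s b t|psi psiU psiE] :=
  generated_factor (j := lambda act) gen.
- by move=> a; rewrite (glob_act1 _ gl).
- by move=> a; rewrite (glob_act1 _ globalization_lambda).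
- by rewrite !lambda_gact; exact: gact_eq_fas.
- by exists psi => // a s; rewrite psiE lambda_gact.
Qed.

End Universality.

Theorem theorem5p1 (S : monoidType) (A : Type) (act : strong_paction S A) :
  [/\ (exists (hglob : globalization act (delta act)) (hgen : generated (delta act)),
         @initial (gen_glob_cat act) (GenGlob hglob hgen)),
      (exists (hglob : globalization act (lambda act)) (hgen : generated (lambda act)),
         @terminal (gen_glob_cat act) (GenGlob hglob hgen))
    & forall (B : global_act S) (iota : A -> B),
        globalization act iota -> generated iota ->
        (exists2 phi : tensor_act act -> B,
           unique (fun phi : tensor_act act -> B =>
                     act_morphism phi /\ phi \o delta act = iota) phi
         & forall a s, phi (tens act a s) = gact (iota a) s) /\
        (exists2 psi : B -> fspace_act act,
           unique (fun psi : B -> fspace_act act =>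
                     act_morphism psi /\ psi \o iota = lambda act) psi
         & forall a s, psi (gact (iota a) s) = fas act a s)].
Proof.
split.
- exists (globalization_delta act), (@generated_delta _ _ act) => Y.
  have [phi [phiP phiU] _] := tensor_universal (gg_glob Y).
  exists (exist _ phi phiP) => -[g gP]; apply: gg_hom_eq.
  by rewrite /= (phiU _ gP).
- exists (globalization_lambda act), (@generated_lambda _ _ act) => Y.
  have [psi [psiP psiU] _] := fspace_universal (gg_glob Y) (gg_gen (g := Y)).
  exists (exist _ psi psiP) => -[g gP]; apply: gg_hom_eq.
  by rewrite /= (psiU _ gP).
- by move=> B iota gl gen; split; [exact: tensor_universal|exact: fspace_universal].
Qed.
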